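(* Let $L_1,\dots,L_n$ be lines in $\mathbb{R}^3$ such that $$d(L_i,L_j):=\min_{x\in L_i,\,y\in L_j}\|x-y\|=1\qquad\text{for all }1\le i<j\le n.$$ Then $n\le 18$.
   Context: $\|\cdot\|$ is the Euclidean norm on $\mathbb{R}^3$; lines are (affine) lines in $\mathbb{R}^3$. *)

(* Defs.v *)
From HB Require Import structures.
From mathcomp Require Import all_boot all_order all_algebra.
From mathcomp Require Import reals.
Set Implicit Arguments. Unset Strict Implicit. Unset Printing Implicit Defensive.
Import Order.TTheory GRing.Theory Num.Theory.
Local Open Scope ring_scope.

Definition enorm (R : realType) (x : 'rV[R]_3) : R :=
  Num.sqrt (\sum_(i < 3) x ord0 i ^+ 2).

Definition is_line (R : realType) (L : 'rV[R]_3 -> Prop) : Prop :=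
  exists (p v : 'rV[R]_3), v != 0 /\
    forall x, L x <-> exists t : R, x = p + t *: v.

Definition line_dist_is (R : realType) (L M : 'rV[R]_3 -> Prop) (d : R) : Prop :=
  (exists x y, L x /\ M y /\ enorm (x - y) = d) /\
  (forall x y, L x -> M y -> d <= enorm (x - y)).

(* Main.v *)
Require Import Defs.
From HB Require Import structures.
From mathcomp Require Import all_boot all_order all_algebra.
From mathcomp Require Import reals.
From mathcomp Require Import zify ring lra.
Import Order.TTheory GRing.Theory Num.Theory.

(* Give line [i] a unit direction [v_i] and moment [m_i = p_i x v_i].  Distance 1
   between nonparallel lines means that the reciprocal product
   [M_ij = v_i . m_j + v_j . m_i] equals [eps_ij sqrt (1 - (v_i . v_j)^2)] with a
   sign [eps_ij].  The matrix of the [sqrt (1 - (v_i . v_j)^2)] is strictly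
   negative definite on vectors of sum zero, whereas [M] has signature at most
   (3, 3); hence no reorientation of five of the lines makes all ten signs equal.
   Reorient every line so that its sign with line 0 is +; then the other lines
   contain no four with equal mutual signs, and R(4, 4) <= 18 gives n - 1 <= 17.
   If two lines are parallel, all the others lie in four planes containing at
   most two lines each. *)

(** * Ramsey numbers *)

Section Ramsey.
Variable T : finType.
Implicit Types (e : rel T) (A B S : {set T}).

Definition clique e k A := exists S : {set T},
  [/\ S \subset A, #|S| = k & {in S &, forall x y, x != y -> e x y}].

Definition neigh e A x := [set y in A | (y != x) && e x y].

Definition ramsey m a b := forall e A, symmetric e -> (m <= #|A|)%N ->
  clique e a A \/ clique (fun x y => ~~ e x y) b A.

Lemma clique_subset e k A B : A \subset B -> clique e k A -> clique e k B.
Proof.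
move=> AB [S [SA cS hS]]; exists S; split=> //; exact: subset_trans AB.
Qed.

Lemma clique_neigh e k A x : symmetric e -> x \in A ->
  clique e k (neigh e A x) -> clique e k.+1 A.
Proof.
move=> es xA [S [/subsetP SN cS hS]]; exists (x |: S).
have NP y : y \in S -> [/\ y \in A, y != x & e x y].
  by move=> /SN; rewrite inE => /and3P[].
split.
- by apply/subsetP=> y /setU1P[->//|/NP[]].
- rewrite cardsU1 cS; case: (boolP (x \in S)) => // /NP[_].
  by rewrite eqxx.
- move=> y z /setU1P[->|yS] /setU1P[->|zS] yz.
  + by rewrite eqxx in yz.
  + by case: (NP z zS).
  + by rewrite es; case: (NP y yS).
  + exact: hS.
Qed.

Lemma card_neigh e {A x} : x \in A ->
  (#|neigh e A x| + #|neigh (fun x y => ~~ e x y) A x|).+1 = #|A|.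
Proof.
move=> xA; rewrite (cardsD1 x A) xA add1n; congr _.+1.
rewrite -cardsUI.
have -> : neigh e A x :&: neigh (fun x y => ~~ e x y) A x = set0.
  by apply/setP=> y; rewrite !inE; case: (e x y); rewrite !(andbF, andbT).
rewrite cards0 addn0; apply: eq_card => y; rewrite !inE.
by case: (e x y); case: (y \in A); case: (y == x).
Qed.

(** Handshake lemma by deleting a vertex [x]: it contributes its own degree and one unit to the
    degree of each neighbour, in total twice its degree. *)
Lemma odd_sum_neigh {e} A : symmetric e -> ~~ odd (\sum_(x in A) #|neigh e A x|).
Proof.
move=> es; move cA: #|A| => n; elim: n A cA => [|n IH] A cA.
  by move/cards0_eq: cA => ->; rewrite big_set0.
have [x xA] : exists x, x \in A by apply/card_gt0P; rewrite cA.
rewrite (big_setD1 x) //=.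
have NE y : y \in A :\ x -> #|neigh e A y| = (e x y + #|neigh e (A :\ x) y|)%N.
  rewrite in_setD1 => /andP[yx yA].
  rewrite (cardsD1 x) inE xA eq_sym yx es /=; congr (_ + _)%N.
  by apply: eq_card => z; rewrite !inE; case: (z == x).
rewrite (eq_bigr _ NE) big_split /= addnA oddD.
have -> : (\sum_(y in A :\ x) e x y = #|neigh e A x|)%N.
  rewrite -sum1_card big_mkcond [RHS]big_mkcond /=; apply: eq_bigr => y _.
  by rewrite !inE; case: (e x y); case: (y == x); case: (y \in A).
rewrite addnn odd_double; apply: IH.
by have := cardsD1 x A; rewrite xA cA add1n => -[].
Qed.

Lemma ramsey_sym m a b : ramsey m a b -> ramsey m b a.
Proof.
move=> h e A es mA.
have es' : symmetric (fun x y => ~~ e x y) by move=> x y; rewrite es.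
case: (h _ A es' mA) => h1; [by right|left].
case: h1 => S [SA cS hS]; exists S; split=> // x y xS yS xy.
by move: (hS x y xS yS xy); rewrite negbK.
Qed.

Lemma ramsey1 b : ramsey 1 1 b.
Proof.
move=> e A _ /card_gt0P[x xA]; left; exists [set x]; split.
- by rewrite sub1set.
- exact: cards1.
- by move=> y z /set1P-> /set1P->; rewrite eqxx.
Qed.

(** Inside a large neighbourhood of [x] in one colour, a clique of that colour grows by [x]; a
    clique of the other colour already has full size. *)
Lemma ramsey_neigh {n m a b e A x} : symmetric e -> x \in A ->
  ramsey n a b.+1 -> ramsey m a.+1 b ->
  (n <= #|neigh e A x|)%N \/ (m <= #|neigh (fun x y => ~~ e x y) A x|)%N ->
  clique e a.+1 A \/ clique (fun x y => ~~ e x y) b.+1 A.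
Proof.
move=> es xA hn hm.
have es' : symmetric (fun x y => ~~ e x y) by move=> y z; rewrite es.
have subN f : neigh f A x \subset A by apply/subsetP=> y; rewrite inE => /andP[].
case=> [/(hn _ _ es)|/(hm _ _ es)] [] h.
- by left; apply: clique_neigh h.
- by right; apply: clique_subset h.
- by left; apply: clique_subset h.
- by right; apply: clique_neigh h.
Qed.

(** Erdős-Szekeres recursion: the two degrees of any vertex sum to at least n + m - 1, so one of
    them reaches [n] or the other reaches [m]. *)
Lemma ramseyS n m a b : (0 < n + m)%N ->
  ramsey n a b.+1 -> ramsey m a.+1 b -> ramsey (n + m) a.+1 b.+1.
Proof.
move=> nm0 hn hm e A es nmA.
have /card_gt0P[x xA] : (0 < #|A|)%N by apply: leq_trans nmA.
apply: (ramsey_neigh es xA hn hm).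
by have := card_neigh e xA; lia.
Qed.

(* If neither colour works, every vertex has degree exactly [n.*2.-1] inside an
   odd vertex set, contradicting the handshake lemma. *)
Lemma ramseyS_even n m a b : (0 < n)%N ->
  ramsey n.*2 a b.+1 -> ramsey m.*2 a.+1 b ->
  ramsey (n.*2 + m.*2).-1 a.+1 b.+1.
Proof.
move=> nm0 hn hm e A es nmA.
(* The parity argument needs the exact cardinality, so [A] is shrunk to a subset [B] of that
   size. *)
have [B] : exists B, B \subset A /\ #|B| = (n.*2 + m.*2).-1.
  have : (0 < #|[set B : {set T} | (B \subset A) && (#|B| == (n.*2 + m.*2).-1)]|)%N.
    by rewrite cards_draws bin_gt0.
  by case/card_gt0P=> B; rewrite inE => /andP[BA /eqP cB]; exists B.
case=> BA cB; suff [h|h] : clique e a.+1 B \/ clique (fun x y => ~~ e x y) b.+1 B.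
- by left; apply: clique_subset h.
- by right; apply: clique_subset h.
have [|all_eq] := boolP [exists x in B, #|neigh e B x| != n.*2.-1].
  case/existsP=> x /andP[xB degx]; apply: (ramsey_neigh es xB hn hm).
  by have := card_neigh e xB; move/eqP: degx; lia.
have := odd_sum_neigh B es.
rewrite (eq_bigr (fun=> n.*2.-1)); last first.
  move=> x xB; apply/eqP; apply: contraNT all_eq => h.
  by apply/existsP; exists x; rewrite xB.
rewrite sum_nat_const cB oddM.
rewrite -(prednK nm0) doubleS /= odd_double andbT.
by rewrite -doubleD odd_double.
Qed.

Lemma ramsey44 : ramsey 18 4 4.
Proof.
have r22 : ramsey 2 2 2 by apply: (@ramseyS 1 1) => //; [|apply: ramsey_sym]; exact: ramsey1.
have r23 : ramsey 3 2 3 by apply: (@ramseyS 1 2) => //; exact: ramsey1.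
have r24 : ramsey 4 2 4 by apply: (@ramseyS 1 3) => //; exact: ramsey1.
have r33 : ramsey 6 3 3 by apply: (@ramseyS 3 3) => //; apply: ramsey_sym.
(* Both 4 and 6 are even, so 4 + 6 improves to 9; without this gain the final bound would be 20. *)
have r34 : ramsey 9 3 4 by apply: (@ramseyS_even 2 3).
by apply: (@ramseyS 9 9) => //; apply: ramsey_sym.
Qed.
End Ramsey.

Local Open Scope ring_scope.

(** * Strict negative type of the sine kernel *)

Section NegativeType.
Local Notation nnegp := (polyOver (@Num.Def.nneg_num_pred _)).
Variables (R : realType) (n d : nat) (v : 'I_n -> 'I_d -> R).

Let ip i j := \sum_(k < d) v i k * v j k.

(** Schur product argument: expanding one factor [ip i j] over the coordinates [k] turns the weights
    x_i into x_i v_ik and lowers the exponent. *)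
Lemma gram_exp_ge0 m (x : 'I_n -> R) :
  0 <= \sum_i \sum_j x i * x j * ip i j ^+ m.
Proof.
elim: m x => [|m IH] x.
  rewrite (_ : \sum_i _ = (\sum_i x i) ^+ 2) ?sqr_ge0// expr2 mulr_suml.
  by apply: eq_bigr => i _; rewrite mulr_sumr; apply: eq_bigr => j _; rewrite mulr1.
rewrite (_ : \sum_i _ = \sum_(k < d) \sum_i \sum_j
    (x i * v i k) * (x j * v j k) * ip i j ^+ m); first exact: sumr_ge0.
rewrite [RHS]exchange_big /=; apply: eq_bigr => i _.
rewrite [RHS]exchange_big /=; apply: eq_bigr => j _.
rewrite exprS {1}/ip mulrA mulr_sumr mulr_suml.
by apply: eq_bigr => k _; ring.
Qed.

Lemma gram_poly_ge0 (p : {poly R}) (x : 'I_n -> R) :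
  p \is a nnegp -> 0 <= \sum_i \sum_j x i * x j * p.[ip i j ^+ 2].
Proof.
move=> /polyOverP p0.
rewrite (_ : \sum_i _ = \sum_(m < size p) p`_m *
    \sum_i \sum_j x i * x j * ip i j ^+ (2 * m)).
  by apply: sumr_ge0 => m _; apply: mulr_ge0 (gram_exp_ge0 _ _); rewrite -nnegrE.
rewrite (eq_bigr _ (fun m _ => mulr_sumr _ _ _ _)) [RHS]exchange_big /=.
apply: eq_bigr => i _.
rewrite (eq_bigr _ (fun m _ => mulr_sumr _ _ _ _)) [RHS]exchange_big /=.
apply: eq_bigr => j _.
rewrite horner_coef mulr_sumr; apply: eq_bigr => m _.
by rewrite exprM; ring.
Qed.
End NegativeType.

(** * Polynomial approximation of 1 - sqrt (1 - t) with nonnegative coefficients *)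

Section SqrtPoly.
Variable R : realType.
Local Notation nnegp := (polyOver (@Num.Def.nneg_num_pred R)).

(** Iteration from 0 towards the smaller root y = 1 - sqrt (1 - t) of y = (t + y^2) / 2. *)
Fixpoint sqrtp k : {poly R} :=
  if k is k'.+1 then 2^-1 *: ('X + sqrtp k' ^+ 2) else 0.

Let f (t : R) := 1 - Num.sqrt (1 - t).

(** Each increment is half the previous increment times the sum of the two previous iterates, so
    nonnegativity of coefficients propagates. *)
Lemma sqrtpS_ge0 k : sqrtp k.+1 - sqrtp k \is a nnegp /\
   sqrtp k \is a nnegp.
Proof.
elim: k => [|k [IH1 IH2]].
  split; last exact: rpred0.
  rewrite /= subr0 expr0n addr0; apply: polyOverZ; last exact: polyOverX.
  by rewrite nnegrE invr_ge0.
have h : sqrtp k.+1 \is a nnegp.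
  by rewrite -(subrK (sqrtp k) (sqrtp k.+1)) rpredD.
split=> //.
rewrite (_ : _ - _ = 2^-1 *: ((sqrtp k.+1 - sqrtp k) * (sqrtp k.+1 + sqrtp k))).
  apply: polyOverZ; first by rewrite nnegrE invr_ge0.
  by rewrite rpredM // rpredD.
rewrite -subr_sqr [LHS]/= -/(sqrtp k.+1) -scalerBr; congr (_ *: _).
by rewrite opprD addrACA subrr add0r.
Qed.

Lemma sqrtp_polyOver k : sqrtp k \is a nnegp.
Proof. by case: (sqrtpS_ge0 k). Qed.

Lemma sqrtp_mono k m : (k <= m)%N -> sqrtp m - sqrtp k \is a nnegp.
Proof.
move=> /subnK <-; elim: (m - k)%N => [|j IH]; first by rewrite subrr rpred0.
rewrite addSn -(subrK (sqrtp (j + k)) (sqrtp _.+1)) -addrA rpredD //.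
by case: (sqrtpS_ge0 (j + k)).
Qed.

(** Each squaring step doubles the degree of the monomial and keeps its coefficient positive. Such
    monomials of arbitrarily high degree are the source of strictness. *)
Lemma sqrtp_monomial k : exists2 c : R, 0 < c &
  sqrtp k.+1 - c *: 'X^(2 ^ k) \is a nnegp.
Proof.
elim: k => [|k [c c0 IH]].
  exists 2^-1; first by rewrite invr_gt0.
  by rewrite /= expr0n addr0 expn0 expr1 subrr rpred0.
exists (2^-1 * c ^+ 2); first by rewrite mulr_gt0 ?exprn_gt0 ?invr_gt0.
set q := sqrtp k.+1 in IH *.
have X0 : 'X \is a nnegp by exact: polyOverX.
have h : 2^-1 *: ('X + ((q - c *: 'X^(2 ^ k)) ^+ 2 +
     (c *: 'X^(2 ^ k)) * (q - c *: 'X^(2 ^ k)) *+ 2)) \is a nnegp.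
  apply: polyOverZ; first by rewrite nnegrE invr_ge0.
  rewrite rpredD // rpredD ?rpredX // rpredMn // rpredM //.
  by apply: polyOverZ; rewrite ?rpredX // nnegrE ltW.
rewrite (_ : _ - _ = 2^-1 *: ('X + ((q - c *: 'X^(2 ^ k)) ^+ 2 +
     (c *: 'X^(2 ^ k)) * (q - c *: 'X^(2 ^ k)) *+ 2))) //.
rewrite [sqrtp k.+2]/= -/(sqrtp k.+1) -/q -scalerA -scalerBr -addrA.
congr (_ *: (_ + _)).
rewrite expnS mulnC exprM -exprZn; ring.
Qed.

(** One iteration multiplies the error by (f t + p) / 2, where 0 <= p <= f t <= t. *)
Lemma sqrtp_approx k (t : R) : 0 <= t <= 1 ->
  0 <= f t - (sqrtp k).[t] <= t ^+ k.
Proof.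
move=> /andP[t0 t1].
have s2 : Num.sqrt (1 - t) ^+ 2 = 1 - t by rewrite sqr_sqrtr ?subr_ge0.
have s0 : 0 <= Num.sqrt (1 - t) by rewrite sqrtr_ge0.
have ft : f t = (t + f t ^+ 2) / 2 by rewrite /f; move: s2; lra.
have f0 : 0 <= f t by rewrite /f; nra.
have f1 : f t <= t by rewrite /f; nra.
elim: k => [|k /andP[IH0 IH1]].
  by rewrite /= horner0 subr0 expr0 f0 /=; apply: le_trans f1 t1.
have p0 : 0 <= (sqrtp k).[t].
  rewrite horner_coef sumr_ge0 // => i _; rewrite mulr_ge0 ?exprn_ge0 //.
  by have /polyOverP := sqrtp_polyOver k; apply.
rewrite /= !hornerE {1 2}ft.
set p := (sqrtp k).[t] in IH0 IH1 p0 *.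
have -> : (t + f t ^+ 2) / 2 - 2^-1 * (t + p ^+ 2) = (f t - p) * ((f t + p) / 2).
  by field.
rewrite exprSr mulr_ge0 //=; last by nra.
apply: ler_pM => //; [nra|nra].
Qed.

End SqrtPoly.

(** * Strictness through high entrywise powers *)

Section StrictNegativeType.
Variable R : realType.

Lemma bernoulli (h : R) k : 0 <= h -> 1 + h *+ k <= (1 + h) ^+ k.
Proof.
move=> h0; elim: k => [|k IH]; first by rewrite mulr0n addr0 expr0.
have hk : 0 <= h *+ k by rewrite mulrn_wge0.
rewrite exprS mulrS; apply: le_trans (ler_wpM2l _ IH); nra.
Qed.

Lemma expr_lt_ex (r e : R) : 0 <= r < 1 -> 0 < e -> exists k, r ^+ k < e.
Proof.
move=> /andP[r0 r1] e0; have [->|rn0] := eqVneq r 0.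
  by exists 1; rewrite expr1.
have rp : 0 < r by rewrite lt0r rn0.
pose h := r^-1 - 1; have h0 : 0 < h by rewrite subr_gt0 invf_gt1.
exists (Num.bound (e^-1 / h)); set k := Num.bound _.
have : e^-1 / h < k%:R by apply: archi_boundP; rewrite divr_ge0 ?invr_ge0 // ltW.
rewrite ltr_pdivrMr // mulrC mulr_natr => hk.
have : e^-1 < r^-1 ^+ k.
  have := @bernoulli h k (ltW h0); rewrite (_ : 1 + h = r^-1); [lra | by rewrite /h addrC subrK].
by rewrite exprVn ltf_pV2 // posrE exprn_gt0.
Qed.

Variables (n : nat) (x : 'I_n -> R).

(** An off-diagonal term is at least -r |x_i x_j|; giving up a further r x_i^2 on the diagonal
    completes the square of the sum of the |x_i|. *)
Lemma quad_form_ge (h : 'I_n -> 'I_n -> R) (D r : R) :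
  0 <= r -> (forall i, D <= h i i) ->
  (forall i j, i != j -> 0 <= h i j <= r) ->
  D * (\sum_i x i ^+ 2) - r * (\sum_i `|x i|) ^+ 2 <=
  \sum_i \sum_j x i * x j * h i j.
Proof.
move=> r0 hD hr.
rewrite [leLHS](_ : _ = \sum_i \sum_j
    ((i == j)%:R * (D * x i ^+ 2) - r * `|x i * x j|)); last first.
  rewrite expr2 mulr_suml !mulr_sumr -sumrB; apply: eq_bigr => i _.
  rewrite sumrB; congr (_ - _); last first.
    by rewrite !mulr_sumr; apply: eq_bigr => j _; rewrite normrM.
  rewrite (bigD1 i) //= eqxx mul1r big1 ?addr0 // => j.
  by rewrite eq_sym => /negPf->; rewrite mul0r.
apply: ler_sum => i _; apply: ler_sum => j _.
have [<-|ij] := eqVneq i j.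
  rewrite mul1r -expr2 ger0_norm ?sqr_ge0 // -mulrBl [leRHS]mulrC.
  by apply: ler_wpM2r (sqr_ge0 _) _ _ _; have := hD i; lra.
have /andP[h0 h1] := hr i j ij.
rewrite mul0r add0r; set u := x i * x j.
apply: (@le_trans _ _ (- (h i j * `|u|))).
  by rewrite lerN2; apply: ler_wpM2r.
rewrite [leRHS]mulrC -mulrN; apply: ler_wpM2l => //.
by rewrite lerNl -normrN ler_norm.
Qed.

Variables (d : nat) (v : 'I_n -> 'I_d -> R).
Let ip i j := \sum_(k < d) v i k * v j k.

(* [sqrt (1 - t) = 1 - sum_m a_m t^m] with [a_m > 0], and entrywise powers of a
   Gram matrix are positive semidefinite; high powers tend to the identity,
   whence strictness. *)
Lemma sqrt_gram_neg : (forall i, ip i i = 1) ->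
  (forall i j, i != j -> ip i j ^+ 2 < 1) ->
  \sum_i x i = 0 -> (exists i, x i != 0) ->
  \sum_i \sum_j x i * x j * Num.sqrt (1 - ip i j ^+ 2) < 0.
Proof.
move=> ip1 iplt x0 [i0 xi0].
pose Q (h : 'I_n -> 'I_n -> R) := \sum_i \sum_j x i * x j * h i j.
have QD h1 h2 : Q (fun i j => h1 i j + h2 i j) = Q h1 + Q h2.
  rewrite /Q -big_split; apply: eq_bigr => i _ /=; rewrite -big_split.
  by apply: eq_bigr => j _ /=; rewrite mulrDr.
have Q_ext h1 h2 : (forall i j, h1 i j = h2 i j) -> Q h1 = Q h2.
  by move=> e; apply: eq_bigr => i _; apply: eq_bigr => j _; rewrite e.
set S := \sum_i x i ^+ 2; have S0 : 0 < S.
  rewrite /S (bigD1 i0) //= ltr_pwDl ?exprn_even_gt0 // sumr_ge0 // => i _.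
  exact: sqr_ge0.
set N := (\sum_i `|x i|) ^+ 2; have N0 : 0 <= N by exact: sqr_ge0.
have N1 : 0 < N + 1 by lra.
(* Uniform bound for the squared cosines off the diagonal, below 1 because there are finitely many;
   the default 0 covers the absence of pairs. *)
pose rho := \big[Num.max/0]_(p : 'I_n * 'I_n | p.1 != p.2) ip p.1 p.2 ^+ 2.
have rho0 : 0 <= rho by exact: bigmax_ge_id.
have rho1 : rho < 1.
  by apply: bigmax_lt => [|[i j] /= ij]; [exact: ltr01|exact: iplt].
have iprho i j : i != j -> 0 <= ip i j ^+ 2 <= rho.
  move=> ij; rewrite sqr_ge0 /=.
  exact: (@le_bigmax_cond _ _ _ 0 (i, j) (fun p => p.1 != p.2)
                          (fun p => ip p.1 p.2 ^+ 2)).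
clearbody rho.
have rhole a b : (a <= b)%N -> rho ^+ b <= rho ^+ a.
  by move=> ab; apply: ler_wiXn2l => //; exact: ltW.
have iprhok k i j : i != j -> 0 <= (ip i j ^+ 2) ^+ k <= rho ^+ k.
  move=> ij; have /andP[h0 h1] := iprho i j ij.
  by rewrite exprn_ge0 //= lerXn2r // nnegrE.
have ipt i j : 0 <= ip i j ^+ 2 <= 1.
  have [<-|ij] := eqVneq i j; first by rewrite ip1 expr1n ler01 lexx.
  by rewrite sqr_ge0 ltW ?iplt.
have small e : 0 < e -> exists k, rho ^+ k * N < e.
  move=> e0; have [||k hk] := @expr_lt_ex rho (e / (N + 1)).
  - by rewrite rho0.
  - by rewrite divr_gt0.
  exists k; rewrite ltr_pdivlMr // in hk.
  by have := exprn_ge0 k rho0; rewrite mulrDr mulr1 in hk; lra.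
(* Since 2^m > m, the entrywise power 2^m is close enough to the identity for its form to be
   positive at [x]. *)
have [m hm] := small S S0.
have [c c0 hc] := sqrtp_monomial R m.
have QX : 0 < Q (fun i j => (ip i j ^+ 2) ^+ (2 ^ m)).
  have := @quad_form_ge (fun i j => (ip i j ^+ 2) ^+ (2 ^ m)) 1 (rho ^+ (2 ^ m))
    (exprn_ge0 _ rho0) _ (iprhok _).
  rewrite mul1r -/S -/N => h; apply: lt_le_trans (h _); last first.
    by move=> i; rewrite ip1 !expr1n.
  rewrite subr_gt0; apply: le_lt_trans hm; apply: ler_wpM2r => //.
  by apply: rhole; exact: ltnW (ltn_expl _ _).
have [k hk] := small (c * Q (fun i j => (ip i j ^+ 2) ^+ (2 ^ m))) (mulr_gt0 c0 QX).
(* Large enough for the approximation error to stay below the gain from the monomial, and for the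
   iterate to dominate the one that contains the monomial. *)
pose k' := maxn k m.+1.
have Qp p : p \is a (polyOver (@Num.Def.nneg_num_pred R)) ->
   0 <= Q (fun i j => p.[ip i j ^+ 2]) by exact: gram_poly_ge0.
have Q1 := Qp _ hc.
have Q2 := Qp _ (@sqrtp_mono R m.+1 k' (leq_maxr _ _)).
have Q3 := @quad_form_ge (fun i j => (1 - Num.sqrt (1 - ip i j ^+ 2)) -
   (sqrtp R k').[ip i j ^+ 2]) 0 (rho ^+ k') (exprn_ge0 _ rho0).
rewrite mul0r add0r -/N in Q3.
have {}Q3 : - (rho ^+ k' * N) <= Q (fun i j => (1 - Num.sqrt (1 - ip i j ^+ 2)) -
   (sqrtp R k').[ip i j ^+ 2]).
  apply: Q3 => [i|i j ij]; first by case/andP: (sqrtp_approx R k' _ (ipt i i)).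
  have /andP[-> /= h] := sqrtp_approx R k' _ (ipt i j).
  by apply: le_trans h _; case/andP: (iprhok k' i j ij).
have Q4 : rho ^+ k' * N <= rho ^+ k * N.
  by apply: ler_wpM2r => //; apply: rhole; exact: leq_maxl.
have Q0 : Q (fun i j => 1) = 0.
  transitivity ((\sum_i x i) * (\sum_i x i)); last by rewrite x0 mulr0.
  rewrite mulr_suml; apply: eq_bigr => i _; rewrite mulr_sumr.
  by apply: eq_bigr => j _; rewrite mulr1.
have QZ b h : Q (fun i j => b * h i j) = b * Q h.
  rewrite /Q mulr_sumr; apply: eq_bigr => i _; rewrite mulr_sumr.
  by apply: eq_bigr => j _; rewrite mulrCA.
rewrite -/(Q _).
(* The five kernels add up to the constant 1, whose form vanishes as [x] has sum zero. The third and
   fourth forms are nonnegative and the last outweighs the error, so the first is negative. *)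
have : Q (fun i j => Num.sqrt (1 - ip i j ^+ 2)) +
   Q (fun i j => (1 - Num.sqrt (1 - ip i j ^+ 2)) - (sqrtp R k').[ip i j ^+ 2]) +
   Q (fun i j => (sqrtp R k' - sqrtp R m.+1).[ip i j ^+ 2]) +
   Q (fun i j => (sqrtp R m.+1 - c *: 'X^(2 ^ m)).[ip i j ^+ 2]) +
   c * Q (fun i j => (ip i j ^+ 2) ^+ (2 ^ m)) = 0.
  rewrite -QZ -!QD -Q0; apply: Q_ext => i j.
  move: (sqrtp R k') (sqrtp R m.+1) => p1 p2; rewrite !hornerD !hornerN hornerZ hornerXn.
  ring.
lra.
Qed.
End StrictNegativeType.

(** * Lines at unit distance *)

Section Geometry.
Variable R : realType.
Implicit Types (a b p q u v w x y z : 'rV[R]_3) (s t : R).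

(** * Vector algebra in three dimensions *)

Definition dot u v : R := \sum_(k < 3) u 0 k * v 0 k.

(** Indices are added modulo 3, so a single formula gives all coordinates. *)
Definition cross u v : 'rV[R]_3 := \row_k
  (u 0 (k + 1) * v 0 (k + 2) - u 0 (k + 2) * v 0 (k + 1)).

Lemma dotE u v : dot u v = u 0 0 * v 0 0 + u 0 1 * v 0 1 + u 0 2 * v 0 2.
Proof.
rewrite /dot !big_ord_recl big_ord0 addr0 addrA.
by congr (_ + _ + _); congr (u _ _ * v _ _); apply: val_inj.
Qed.

Lemma cross0 u v : cross u v 0 0 = u 0 1 * v 0 2 - u 0 2 * v 0 1.
Proof. by rewrite mxE; congr (u _ _ * v _ _ - u _ _ * v _ _); apply: val_inj. Qed.

Lemma cross1 u v : cross u v 0 1 = u 0 2 * v 0 0 - u 0 0 * v 0 2.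
Proof. by rewrite mxE; congr (u _ _ * v _ _ - u _ _ * v _ _); apply: val_inj. Qed.

Lemma cross2 u v : cross u v 0 2 = u 0 0 * v 0 1 - u 0 1 * v 0 0.
Proof. by rewrite mxE; congr (u _ _ * v _ _ - u _ _ * v _ _); apply: val_inj. Qed.

(* [mxE] would also unfold [cross] with indices left in the form [0 + 1]. *)
Lemma coordD u v k : (u + v) 0 k = u 0 k + v 0 k. Proof. by rewrite mxE. Qed.
Lemma coordN u k : (- u) 0 k = - u 0 k. Proof. by rewrite mxE. Qed.
Lemma coordZ s u k : (s *: u) 0 k = s * u 0 k. Proof. by rewrite mxE. Qed.

Definition coordE := (dotE, coordD, coordN, coordZ, cross0, cross1, cross2).

Lemma row3P u v : u 0 0 = v 0 0 -> u 0 1 = v 0 1 -> u 0 2 = v 0 2 -> u = v.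
Proof.
move=> e0 e1 e2; apply/rowP => -[[|[|[|k]]] Hk] //.
- by rewrite (_ : Ordinal Hk = 0); last exact: val_inj.
- by rewrite (_ : Ordinal Hk = 1); last exact: val_inj.
- by rewrite (_ : Ordinal Hk = 2); last exact: val_inj.
Qed.

Lemma dotC u v : dot u v = dot v u.
Proof. by rewrite !coordE; ring. Qed.
Lemma dotDl u v w : dot (u + v) w = dot u w + dot v w.
Proof. by rewrite !coordE; ring. Qed.
Lemma dotDr u v w : dot w (u + v) = dot w u + dot w v.
Proof. by rewrite !coordE; ring. Qed.
Lemma dotNl u v : dot (- u) v = - dot u v.
Proof. by rewrite !coordE; ring. Qed.
Lemma dotNr u v : dot v (- u) = - dot v u.
Proof. by rewrite !coordE; ring. Qed.
Lemma dotZl s u v : dot (s *: u) v = s * dot u v.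
Proof. by rewrite !coordE; ring. Qed.
Lemma dotZr s u v : dot v (s *: u) = s * dot v u.
Proof. by rewrite !coordE; ring. Qed.
Definition dot_lin := (dotDl, dotDr, dotNl, dotNr, dotZl, dotZr).

Lemma dot_ge0 u : 0 <= dot u u.
Proof. by apply: sumr_ge0 => k _; rewrite -expr2 sqr_ge0. Qed.

Lemma dot_eq0 u : (dot u u == 0) = (u == 0).
Proof.
apply/eqP/eqP => [|->]; last by rewrite /dot big1 // => k _; rewrite mxE mul0r.
move=> /eqP; rewrite /dot psumr_eq0 => [/allP h|k _]; last by rewrite -expr2 sqr_ge0.
apply/rowP => k; rewrite mxE; apply/eqP; have := h k (mem_index_enum _).
by rewrite /= mulf_eq0 orbb.
Qed.

Lemma dot_cross u v : dot (cross u v) (cross u v) =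
  dot u u * dot v v - dot u v ^+ 2.
Proof. by rewrite !coordE; ring. Qed.

Lemma dot_crossl u v : dot u (cross u v) = 0.
Proof. by rewrite !coordE; ring. Qed.

Lemma dot_crossr u v : dot v (cross u v) = 0.
Proof. by rewrite !coordE; ring. Qed.

(** The matrix with rows a, v and a x v satisfies M M^T = 1, hence also M^T M = 1. *)
Lemma frame_expand a v x : dot a a = 1 -> dot v v = 1 -> dot a v = 0 ->
  x = dot x a *: a + dot x v *: v + dot x (cross a v) *: cross a v.
Proof.
move=> aa vv av; set z := cross a v.
have zz : dot z z = 1 by rewrite dot_cross aa vv av expr0n mulr1 subr0.
have az : dot a z = 0 by exact: dot_crossl.
have vz : dot v z = 0 by exact: dot_crossr.
pose f (i : 'I_3) := [:: a; v; z]`_i.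
pose M : 'M[R]_3 := \matrix_(i, k) f i 0 k.
have MM : M *m M^T = 1%:M.
  apply/matrixP => i j; rewrite !mxE.
  rewrite (_ : \sum__ _ = dot (f i) (f j)); last by apply: eq_bigr => k _; rewrite !mxE.
  by case: i => [[|[|[|i]]] Hi] //; case: j => [[|[|[|j]]] Hj] //;
    rewrite /f /= ?aa ?vv ?zz ?av ?az ?vz // dotC ?av ?az ?vz.
rewrite -[LHS]mulmx1 -(mulmx1C MM) mulmxA; apply/rowP => k.
rewrite !mxE !big_ord_recl big_ord0 addr0 addrA.
have E j : (x *m M^T) 0 j = dot x (f j).
  by rewrite mxE; apply: eq_bigr => l _; rewrite !mxE.
by rewrite !E !mxE /f.
Qed.

Lemma dot_frame a v x y : dot a a = 1 -> dot v v = 1 -> dot a v = 0 ->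
  dot x y = dot x a * dot y a + dot x v * dot y v
    + dot x (cross a v) * dot y (cross a v).
Proof.
move=> aa vv av; rewrite {1}(frame_expand a v x) // !dot_lin.
by rewrite (dotC a) (dotC v) (dotC (cross a v)).
Qed.

(** * Unit directions and common perpendiculars *)

Lemma parallel_unit v w : dot v v = 1 -> dot w w = 1 -> dot v w ^+ 2 = 1 ->
  w = dot v w *: v.
Proof.
move=> vv ww vw; apply/eqP; rewrite -subr_eq0 -dot_eq0 !dot_lin vv ww (dotC w v).
by apply/eqP; move: vw; rewrite expr2 => vw; lra.
Qed.

(** Here [a] is a unit common perpendicular joining the two lines; the form is uniform for skew and
    parallel lines. *)
Definition touch p v q w := exists a s t,
  [/\ dot a a = 1, dot a v = 0, dot a w = 0 & p - q = a + s *: v + t *: w].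

(** The reciprocal product equals the triple product of a, v, w, whose square is their Gram
    determinant. *)
Lemma touch_recip p v q w : touch p v q w -> dot v v = 1 -> dot w w = 1 ->
  (dot v (cross q w) + dot w (cross p v)) ^+ 2 = 1 - dot v w ^+ 2.
Proof.
move=> [a [s [t [aa av aw e]]]] vv ww.
have -> : dot v (cross q w) + dot w (cross p v) = dot a (cross v w).
  have -> : p = q + (a + s *: v + t *: w) by rewrite -e addrC subrK.
  by rewrite !coordE; ring.
have -> : dot a (cross v w) ^+ 2 = dot a a * (dot v v * dot w w - dot v w ^+ 2)
   - dot a v * (dot a v * dot w w - dot v w * dot a w)
   + dot a w * (dot a v * dot v w - dot v v * dot a w).
  by rewrite !coordE; ring.
by rewrite aa av aw vv ww; ring.
Qed.

Lemma line_dist_touch (L M : 'rV[R]_3 -> Prop) p v q w :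
  (forall x, L x <-> exists t : R, x = p + t *: v) ->
  (forall x, M x <-> exists t : R, x = q + t *: w) ->
  dot v v = 1 -> dot w w = 1 ->
  line_dist_is L M 1 -> touch p v q w.
Proof.
move=> hL hM vv ww [[x [y [Lx [My xy1]]]] hmin].
have nE u : enorm u ^+ 2 = dot u u.
  rewrite /enorm sqr_sqrtr; first by apply: eq_bigr => k _; rewrite expr2.
  by apply: sumr_ge0 => k _; rewrite sqr_ge0.
have n1 u : 1 <= enorm u -> 1 <= dot u u.
  by move=> h; rewrite -nE exprn_ege1.
have aa : dot (x - y) (x - y) = 1 by rewrite -nE xy1 expr1n.
(* The choice t = - a.u gives squared length 1 - (a.u)^2, which minimality forbids to be below 1. *)
have perp a u : dot a a = 1 -> dot u u = 1 ->
    (forall t, 1 <= enorm (a + t *: u)) -> dot a u = 0.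
  move=> a1 uu h; have := n1 _ (h (- dot a u)).
  rewrite !dot_lin a1 uu (dotC u) => k.
  by apply/eqP; rewrite -sqrf_eq0 eq_le sqr_ge0 andbT expr2; lra.
have /hL[s xE] := Lx; have /hM[t yE] := My.
exists (x - y), (- s), t; split=> //.
- apply: perp => // r; rewrite addrAC; apply: hmin => //.
  by apply/hL; exists (s + r); rewrite xE scalerDl addrA.
- apply: perp => // r; rewrite -addrA.
  rewrite (_ : _ + _ = x - (y - r *: w)); last by rewrite opprB [_ - y]addrC.
  apply: hmin => //.
  by apply/hM; exists (t - r); rewrite yE scalerBl addrA.
- rewrite xE yE; apply/rowP => k; rewrite !mxE; ring.
Qed.

Lemma touch_sym p v q w : touch p v q w -> touch q w p v.
Proof.
move=> [a [s [t [aa av aw e]]]]; exists (- a), (- t), (- s).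
rewrite !dot_lin aa av aw oppr0 opprK; split=> //.
by rewrite -opprB e; apply/rowP => k; rewrite !mxE; ring.
Qed.

Lemma touch_scale p v q w s : touch p v q (s *: w) -> s != 0 -> touch p v q w.
Proof.
move=> [a [r [t [aa av aw e]]]] s0; exists a, r, (t * s); split=> //.
  by move/eqP: aw; rewrite dotZr mulf_eq0 (negPf s0) => /eqP.
by rewrite e scalerA.
Qed.

(** * Lines touching two parallel lines *)

(** Let al, be, ga be the coordinates of [w] in the frame a, v, z. The two reciprocal equations give
    (al c - ga d)^2 = (al c - ga d - ga)^2 = al^2 + ga^2, which forces ga = 0. If al is nonzero then
    c^2 = 1; otherwise all three lines are parallel and their cross-section is a unit equilateral
    triangle, of squared height 3/4. *)
Lemma parallel_heights p v a s r w :
  dot v v = 1 -> dot w w = 1 -> dot a a = 1 -> dot a v = 0 ->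
  touch r w p v -> touch r w (p - a - s *: v) v ->
  dot w (cross a v) = 0 /\
  (dot (r - p) (cross a v) ^+ 2 = 1 \/ dot (r - p) (cross a v) ^+ 2 = 3 / 4).
Proof.
move=> vv ww aa av tp tq; set z := cross a v.
have := touch_recip _ _ _ _ tp ww vv; have := touch_recip _ _ _ _ tq ww vv.
set al := dot w a; set be := dot w v; set ga := dot w z.
set c := dot (r - p) z; set d := dot (r - p) a.
have n1 : al ^+ 2 + be ^+ 2 + ga ^+ 2 = 1.
  by rewrite -ww (dot_frame a v w w) // !expr2.
have M1 : dot w (cross p v) + dot v (cross r w) = al * c - ga * d.
  transitivity (dot (r - p) (cross w v)).
    by rewrite !coordE; ring.
  rewrite (frame_expand a v w) // -/al -/be -/ga -/z.
  transitivity (al * c + ga * dot (r - p) (cross z v)).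
    by rewrite /c /z !coordE; ring.
  rewrite (_ : cross z v = - a); first by rewrite dotNr -/d; ring.
  rewrite (_ : cross z v = dot a v *: v - dot v v *: a).
    by rewrite vv av scale0r scale1r sub0r.
  by apply: row3P; rewrite !coordE; ring.
have -> : dot w (cross (p - a - s *: v) v) + dot v (cross r w) = al * c - ga * d - ga.
  by rewrite -M1 /ga /z !coordE; ring.
rewrite M1 => E2 E1.
have ga0 : ga = 0.
  apply/eqP; apply: contraT => ga0.
  have h : 2 * (al * c - ga * d) = ga by apply: (mulfI ga0); lra.
  have : ga ^+ 2 = 4 * (al ^+ 2 + ga ^+ 2) by rewrite -{1}h; lra.
  have := sqr_ge0 al; have := sqr_ge0 ga; move=> g1 g2 g3.
  have : ga ^+ 2 = 0 by lra.
  by move/eqP; rewrite sqrf_eq0 (negPf ga0).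
split=> //.
have [al0|al0] := eqVneq al 0; last first.
  left; have : al ^+ 2 * c ^+ 2 = al ^+ 2 * 1.
    by rewrite ga0 in E1 n1; move: E1 n1; lra.
  by apply: mulfI; rewrite sqrf_eq0.
right.
have wv : w = be *: v.
  by rewrite (frame_expand a v w) // -/al -/be -/ga al0 ga0 !scale0r add0r addr0.
have [b [k [l [bb _ bv e]]]] := tp; have [b' [k' [l' [bb' _ bv' e']]]] := tq.
have vz : dot v z = 0 by exact: dot_crossr.
have az : dot a z = 0 by exact: dot_crossl.
have va : dot v a = 0 by rewrite dotC.
have d1 : d = dot b a by rewrite /d e wv !dot_lin va; ring.
have c1 : c = dot b z by rewrite /c e wv !dot_lin vz; ring.
have e2 : r - p = b' + k' *: w + l' *: v - a - s *: v.
  by rewrite -e'; apply: row3P; rewrite !coordE; ring.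
have d2 : d = dot b' a - 1 by rewrite /d e2 wv !dot_lin va aa; ring.
have c2 : c = dot b' z by rewrite /c e2 wv !dot_lin vz az; ring.
move: bb bb'; rewrite (dot_frame a v b b) // (dot_frame a v b' b') // bv bv' -/z.
rewrite -d1 -c1 -c2 (_ : dot b' a = d + 1); last by rewrite d2; ring.
move=> f1 f2; have dh : d = - 2^-1 by lra.
by rewrite dh in f1; lra.
Qed.

(** The joining perpendiculars of lines in one plane lie in that plane, so the lines are parallel;
    then a, b and a + b would be unit vectors on a common axis. *)
Lemma coplanar_triple p1 v1 p2 v2 p3 v3 z : dot z z = 1 ->
  dot v1 v1 = 1 -> dot v2 v2 = 1 -> dot v3 v3 = 1 ->
  dot v1 z = 0 -> dot v2 z = 0 -> dot v3 z = 0 ->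
  dot p1 z = dot p2 z -> dot p2 z = dot p3 z ->
  touch p1 v1 p2 v2 -> touch p2 v2 p3 v3 -> touch p1 v1 p3 v3 -> False.
Proof.
move=> zz n1 n2 n3 z1 z2 z3 e12 e23.
have coplanar a v w : dot a a = 1 -> dot a v = 0 -> dot a w = 0 ->
    dot v v = 1 -> dot w w = 1 ->
    dot a z = 0 -> dot v z = 0 -> dot w z = 0 -> w = dot v w *: v.
  move=> aa av aw vv ww az vz wz; apply: parallel_unit => //.
  have : dot a (cross v w) * dot z z = 0.
    transitivity (dot a z * dot z (cross v w) + dot v z * dot z (cross w a)
      + dot w z * dot z (cross a v)); first by rewrite !coordE; ring.
    by rewrite az vz wz; ring.
  rewrite zz mulr1 => a0.
  have : dot a (cross v w) ^+ 2 = dot a a * (dot v v * dot w w - dot v w ^+ 2)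
   - dot a v * (dot a v * dot w w - dot v w * dot a w)
   + dot a w * (dot a v * dot v w - dot v v * dot a w).
    by rewrite !coordE; ring.
  by rewrite a0 aa av aw vv ww; lra.
move=> [a [s1 [t1 [aa av1 av2 ea]]]] [b [s2 [t2 [bb bv2 bv3 eb]]]].
move=> [c [s3 [t3 [cc cv1 cv3 ec]]]].
have az : dot a z = 0.
  have := congr1 (dot^~ z) ea; rewrite !dot_lin e12 z1 z2; lra.
have bz : dot b z = 0.
  have := congr1 (dot^~ z) eb; rewrite !dot_lin e23 z2 z3; lra.
have v2E := coplanar _ _ _ aa av1 av2 n1 n2 az z1 z2.
have v3E := coplanar _ _ _ bb bv2 bv3 n2 n3 bz z2 z3.
have v3E' : v3 = (dot v2 v3 * dot v1 v2) *: v1 by rewrite -scalerA -v2E.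
have v20 : dot v1 v2 != 0.
  by apply/eqP => v0; move: n2; rewrite v2E v0 dotZl mul0r; lra.
have bv1 : dot b v1 = 0.
  by move/eqP: bv2; rewrite v2E dotZr mulf_eq0 (negPf v20) => /eqP.
(* The two sides differ by a multiple of [v1], which vanishes because all three vectors are
   perpendicular to [v1]. *)
have cE : c = a + b.
  pose m := s1 + t1 * dot v1 v2 + s2 * dot v1 v2 + t2 * (dot v2 v3 * dot v1 v2)
            - s3 - t3 * (dot v2 v3 * dot v1 v2).
  have e : c = a + b + m *: v1.
    have : p1 - p3 = (p1 - p2) + (p2 - p3) by rewrite addrA subrK.
    rewrite ea eb ec => h.
    have -> : c = a + s1 *: v1 + t1 *: v2 + (b + s2 *: v2 + t2 *: v3)
       - s3 *: v1 - t3 *: v3 by rewrite -h; apply: row3P; rewrite !coordE; ring.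
    move: (dot v2 v3) (dot v1 v2) v3E' v2E @m => k l -> -> m.
    by apply: row3P; rewrite !coordE /m; ring.
  have : dot c v1 = m by rewrite e !dot_lin av1 bv1 n1; ring.
  by rewrite cv1 => m0; rewrite e -m0 scale0r addr0.
have v1z : dot z v1 = 0 by rewrite dotC.
have abE := dot_frame z v1 a b zz n1 v1z.
have aE := dot_frame z v1 a a zz n1 v1z.
have bE := dot_frame z v1 b b zz n1 v1z.
move: abE aE bE; rewrite az bz av1 bv1 aa bb => abE aE bE.
have ab1 : dot a b ^+ 2 = 1.
  rewrite abE !mul0r !add0r in aE bE *.
  by rewrite expr2 mulrACA -aE -bE mulr1.
move: cc; rewrite cE !dot_lin aa bb (dotC b a) => h.
have {}h : dot a b = - 2^-1 by lra.
by move: ab1; rewrite h; lra.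
Qed.

(** * Five lines with equal signs *)

Lemma left_kernel_vec m k (A : 'M[R]_(m, k)) : (k < m)%N ->
  exists2 x : 'rV_m, x != 0 & x *m A = 0.
Proof.
move=> km; have /rowV0Pn[x xA x0] : kermx A != 0.
  rewrite -mxrank_eq0 mxrank_ker subn_eq0 -ltnNge.
  exact: leq_ltn_trans (rank_leq_col A) km.
by exists x => //; apply/sub_kermxP.
Qed.

(* The reciprocal products form [2 <X, Y>] with [X = sum x_i v_i] and
   [Y = sum x_i m_i]; imposing [X = eps Y] gives it the sign of [eps] on a
   nonzero vector with [sum x_i = 0], against [sqrt_gram_neg]. *)
Lemma no_five_lines (v m : 'I_5 -> 'rV[R]_3) (eps : R) : eps ^+ 2 = 1 ->
  (forall i, dot (v i) (v i) = 1) ->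
  (forall i j, i != j -> dot (v i) (v j) ^+ 2 < 1) ->
  (forall i j, dot (v i) (m j) + dot (v j) (m i) =
     eps * Num.sqrt (1 - dot (v i) (v j) ^+ 2)) -> False.
Proof.
move=> eps1 vv vlt hM.
(* Four linear conditions on five unknowns: zero sum, and the three coordinates of X = eps Y. *)
pose A : 'M[R]_(5, 1 + 3) :=
  row_mx (const_mx 1) (\matrix_(i, k) (v i 0 k - eps * m i 0 k)).
have [x x0] := left_kernel_vec _ _ A isT.
rewrite mul_mx_row -row_mx0 => /eq_row_mx[/rowP/(_ 0) h0 /rowP hk].
have sx : \sum_i x 0 i = 0.
  rewrite !mxE in h0; apply: etrans h0; apply: eq_bigr => i _.
  by rewrite mxE mulr1.
have [i0 xi0] : exists i, x 0 i != 0.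
  by apply/existsP; apply: contraNT x0 => /existsPn h; apply/eqP/rowP => i;
     rewrite mxE; apply/eqP/negPn/h.
have := @sqrt_gram_neg R 5 (fun i => x 0 i) 3 (fun i k => v i 0 k) vv vlt sx
  (ex_intro _ i0 xi0).
pose X k := \sum_i x 0 i * v i 0 k; pose Y k := \sum_i x 0 i * m i 0 k.
have XY k : X k = eps * Y k.
  have := hk k; rewrite !mxE => h; apply/eqP; rewrite -subr_eq0 -h.
  rewrite /X /Y mulr_sumr -sumrB; apply/eqP; apply: eq_bigr => i _.
  by rewrite mxE; ring.
have bil (u w : 'I_5 -> 'rV[R]_3) :
  \sum_i \sum_j x 0 i * x 0 j * dot (u i) (w j) =
  \sum_(k < 3) (\sum_i x 0 i * u i 0 k) * (\sum_j x 0 j * w j 0 k).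
  rewrite [RHS](eq_bigr _ (fun k _ => mulr_suml _ _ _ _)) [RHS]exchange_big.
  apply: eq_bigr => i _ /=.
  rewrite [RHS](eq_bigr _ (fun k _ => mulr_sumr _ _ _ _)) [RHS]exchange_big.
  apply: eq_bigr => j _ /=; rewrite mulr_sumr; apply: eq_bigr => k _; ring.
rewrite (_ : \sum_i _ = \sum_(k < 3) 2 * Y k ^+ 2).
  by rewrite ltNge sumr_ge0 // => k _; rewrite mulr_ge0 ?sqr_ge0.
transitivity (eps * (\sum_i \sum_j x 0 i * x 0 j * dot (v i) (m j) +
                     \sum_i \sum_j x 0 i * x 0 j * dot (m i) (v j))).
  rewrite -big_split mulr_sumr; apply: eq_bigr => i _ /=.
  rewrite -big_split mulr_sumr; apply: eq_bigr => j _ /=.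
  by rewrite -mulrDr (dotC (m i)) hM -[LHS]mul1r -eps1; ring.
rewrite !bil -big_split mulr_sumr; apply: eq_bigr => k _ /=.
rewrite -/(X k) -/(Y k) XY (_ : eps * _ = eps ^+ 2 * (2 * Y k ^+ 2)); last by ring.
by rewrite eps1 mul1r.
Qed.

(** * Counting lines in the presence of a parallel pair *)

Lemma parallel_pair_bound n (p v : 'I_n -> 'rV[R]_3) i0 j0 :
  (forall i, dot (v i) (v i) = 1) ->
  (forall i j, i != j -> touch (p i) (v i) (p j) (v j)) ->
  i0 != j0 -> dot (v i0) (v j0) ^+ 2 = 1 -> (n <= 10)%N.
Proof.
move=> vv ht ij par.
have vE : v j0 = dot (v i0) (v j0) *: v i0 by apply: parallel_unit.
have e0 : dot (v i0) (v j0) != 0.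
  by apply/eqP => h; move: par; rewrite h expr0n /= => /eqP; rewrite eq_sym oner_eq0.
have := ht i0 j0 ij; rewrite vE => /touch_scale/(_ e0).
move=> [a [s [t [aa av _ e]]]].
have pj : p j0 = p i0 - a - (s + t) *: v i0.
  by rewrite -[LHS](subKr (p i0)) e; apply: row3P; rewrite !coordE; ring.
pose z := cross a (v i0); pose c k := dot (p k - p i0) z.
have zz : dot z z = 1 by rewrite dot_cross aa vv av; ring.
have hts k : k != i0 -> k != j0 ->
    dot (v k) z = 0 /\ (c k ^+ 2 = 1 \/ c k ^+ 2 = 3 / 4).
  move=> ki kj; apply: (parallel_heights _ _ _ (s + t)) => //; first exact: ht.
  by rewrite -pj; apply: (touch_scale _ _ _ _ (dot (v i0) (v j0))) => //; rewrite -vE; exact: ht.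
pose B := [set k | (k != i0) && (k != j0)].
have cB : (n <= #|B| + 2)%N.
  have -> : B = ~: [set i0; j0] by apply/setP => k; rewrite !inE negb_or.
  by rewrite -[X in (X <= _)%N](card_ord n) -(cardsC [set i0; j0]) addnC leq_add2l cards2 ij.
rewrite leqNgt; apply/negP => n10.
(* The sign and the value of c^2 distinguish the four heights 1, -1, sqrt 3 / 2 and - sqrt 3 / 2.
   More than 10 lines leave at least 9 outside the pair, so some height occurs three times. *)
pose code k := (0 < c k, c k ^+ 2 == 1).
have [cd] : exists cd, (2 < #|[set k in B | code k == cd]|)%N.
  apply/existsP; apply: contraT => /existsPn h.
  have : (#|B| <= \sum_(cd : bool * bool) 2)%N.
    rewrite -sum1_card (partition_big code xpredT) //=; apply: leq_sum => cd _.
    rewrite sum1_card; have := h cd; rewrite -leqNgt; apply: leq_trans.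
    by apply: subset_leq_card; apply/subsetP => k; rewrite unfold_in !inE.
  by rewrite sum_nat_const card_prod card_bool; lia.
move=> /card_gt2P[k [l [m]]] [[kB lB mB] [kl lm mk]].
have same g h : g \in [set i in B | code i == cd] -> h \in [set i in B | code i == cd] ->
    dot (p g) z = dot (p h) z.
  rewrite !inE => /andP[/andP[k1 k2] /eqP<-] /andP[/andP[l1 l2] /eqP[]].
  have [_ hk] := hts g k1 k2; have [_ hl] := hts h l1 l2.
  move=> s1 s2; suff : c h = c g by rewrite /c !dotDl; lra.
  have : c h ^+ 2 = c g ^+ 2.
    case: hk hl s2 => -> [->|->] //.
    - by rewrite eqxx => /eqP.
    - by rewrite eqxx => /esym/eqP ->.
  (* Opposite heights with the same code would have to be 0, against c^2 being 1 or 3/4. *)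
  move/eqP; rewrite eqf_sqr => /orP[/eqP//|/eqP lk].
  move: s1; rewrite lk oppr_gt0; case: (ltrgt0P (c g)) => // c0 _.
  by move: hk; rewrite c0 expr0n /= => -[]; lra.
have dir g : g \in [set i in B | code i == cd] -> dot (v g) z = 0.
  by rewrite !inE => /andP[/andP[k1 k2] _]; case: (hts g k1 k2).
have km : k != m by rewrite eq_sym.
exact: (coplanar_triple _ _ _ _ _ _ _ zz (vv k) (vv l) (vv m) (dir k kB) (dir l lB)
  (dir m mB) (same _ _ kB lB) (same _ _ lB mB) (ht _ _ kl) (ht _ _ lm) (ht _ _ km)).
Qed.
End Geometry.

(** * Signs of the lines and the Ramsey bound *)

Theorem theorem1 (R : realType) (n : nat) (L : 'I_n -> 'rV[R]_3 -> Prop) :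
  (forall i, is_line (L i)) ->
  (forall i j : 'I_n, (i < j)%N -> line_dist_is (L i) (L j) 1) ->
  (n <= 18)%N.
Proof.
move=> hL hD; rewrite leqNgt; apply/negP => n19.
have /fin_all_exists[pv hpv] : forall i, exists pv : 'rV[R]_3 * 'rV[R]_3,
    dot R pv.2 pv.2 = 1 /\ (forall x, L i x <-> exists t : R, x = pv.1 + t *: pv.2).
  move=> i; have [p [v [v0 hx]]] := hL i.
  have d0 : 0 < dot R v v by rewrite lt0r dot_eq0 v0 dot_ge0.
  have s0 : Num.sqrt (dot R v v) != 0 by rewrite sqrtr_eq0 -ltNge.
  exists (p, (Num.sqrt (dot R v v))^-1 *: v); split=> [|x] /=.
    by rewrite dotZl dotZr mulrA -expr2 exprVn sqr_sqrtr ?ltW // mulVf // gt_eqF.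
  rewrite hx; split=> -[t ->].
  - by exists (t * Num.sqrt (dot R v v)); rewrite scalerA mulfK.
  - by exists (t * (Num.sqrt (dot R v v))^-1); rewrite scalerA.
pose p i := (pv i).1; pose v i := (pv i).2.
have vv i : dot R (v i) (v i) = 1 by case: (hpv i).
have ht i j : i != j -> touch R (p i) (v i) (p j) (v j).
  rewrite neq_ltn => /orP[] ij; last apply: touch_sym.
  - by apply: (line_dist_touch R (L i) (L j)) (hD _ _ ij); rewrite ?vv //; [case: (hpv i)|case: (hpv j)].
  - by apply: (line_dist_touch R (L j) (L i)) (hD _ _ ij); rewrite ?vv //; [case: (hpv j)|case: (hpv i)].
pose m i := cross R (p i) (v i).
pose M i j := dot R (v i) (m j) + dot R (v j) (m i).
have MC i j : M i j = M j i by rewrite /M addrC.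
have M2 i j : i != j -> M i j ^+ 2 = 1 - dot R (v i) (v j) ^+ 2.
  by move=> ij; apply: touch_recip => //; exact: ht.
have vlt i j : i != j -> dot R (v i) (v j) ^+ 2 < 1.
  move=> ij; rewrite lt_neqAle; apply/andP; split; last first.
    by have := sqr_ge0 (M i j); rewrite M2 // subr_ge0.
  apply/eqP => h; have := parallel_pair_bound R n p v i j vv ht ij h; lia.
have MS i j : i != j -> `|M i j| = Num.sqrt (1 - dot R (v i) (v j) ^+ 2).
  by move=> ij; rewrite -M2 // sqrtr_sqr.
have M0 i j : i != j -> M i j != 0.
  by move=> ij; rewrite -sqrf_eq0 M2 // gt_eqF // subr_gt0 vlt.
pose o := Ordinal (leq_trans (isT : 0 < 19)%N n19).
(* Reversing any line flips two of the three factors, so the colour is independent of orientation: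
   it is the sign of the pair once both lines are positive with respect to [o]. *)
pose e i j := 0 < M o i * M o j * M i j.
have es : symmetric e by move=> i j; rewrite /e (mulrC (M o i)) (MC i).
have cA : (18 <= #|~: [set o]|)%N.
  by have := cardsC [set o]; rewrite cards1 card_ord; lia.
have five (S : {set 'I_n}) (eps : R) : eps ^+ 2 = 1 -> S \subset ~: [set o] -> #|S| = 4%N ->
   {in S &, forall i j, i != j -> Num.sg (M o i * M o j * M i j) = eps} -> False.
  move=> eps1 /subsetP So cS hS.
  have oS : o \notin S by apply/negP => /So; rewrite !inE eqxx.
  have c5 : #|o |: S| = 5%N by rewrite cardsU1 oS cS.
  pose g (i : 'I_5) := enum_val (cast_ord (esym c5) i).
  have gi : injective g by move=> i j /enum_val_inj/cast_ord_inj.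
  have gS i : g i = o \/ g i \in S by have /setU1P := enum_valP (cast_ord (esym c5) i).
  (* Reorientation making all ten signs equal to [eps]: within [S] by the choice of colour, and
     against [o] because [o] itself carries [eps]. *)
  pose s i := if i == o then eps else Num.sg (M o i).
  have neqo i : i \in S -> i != o by move=> iS; apply: contraNneq oS => <-.
  have s1 i : i = o \/ i \in S -> s i ^+ 2 = 1.
    rewrite /s => -[->|iS]; first by rewrite eqxx.
    by rewrite (negPf (neqo _ iS)) sqr_sg M0 // eq_sym neqo.
  have sM i j : i = o \/ i \in S -> j = o \/ j \in S -> i != j ->
     s i * s j * M i j = eps * `|M i j|.
    have so k : k \in S -> s o * s k * M o k = eps * `|M o k|.
      by move=> kS; rewrite /s eqxx (negPf (neqo _ kS)) -mulrA -normrEsg.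
    move=> [->|iS] [->|jS] ij; first by rewrite eqxx in ij.
    - exact: so.
    - by rewrite (mulrC (s i)) MC; apply: so.
    - rewrite -(hS i j) // [in LHS](numEsg (M i j)) /s (negPf (neqo _ iS)) (negPf (neqo _ jS)).
      by rewrite !sgrM !mulrA.
  apply: (@no_five_lines R (fun i => s (g i) *: v (g i)) (fun i => s (g i) *: m (g i)) eps) => //.
  - by move=> i; rewrite dotZl dotZr vv mulr1 -expr2 s1.
  - move=> i j ij; rewrite dotZl dotZr !exprMn !s1 // !mul1r vlt //.
    by rewrite (inj_eq gi).
  - move=> i j; rewrite !dotZl !dotZr !exprMn !s1 // !mul1r.
    (* On the diagonal both sides vanish, a direction being perpendicular to its moment. *)
    have [->|ij] := eqVneq i j.
      rewrite vv expr1n subrr sqrtr0 mulr0 (_ : dot R (v _) (m _) = 0).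
        by rewrite !mulr0 addr0.
      exact: dot_crossr.
    rewrite -MS ?(inj_eq gi) // -sM ?(inj_eq gi) // /M; ring.
have := ramsey44 _ e _ es cA.
case=> -[S [So cS hS]].
- by apply: (five S 1) => //; [rewrite expr1n|move=> i j iS jS ij; rewrite gtr0_sg //; exact: hS].
- apply: (five S (-1)) => //; first by rewrite sqrrN expr1n.
  (* The complementary colour only says that the product is at most 0; it is nonzero since no two
     lines are parallel. *)
  move=> i j iS jS ij; rewrite ltr0_sg // lt_neqAle leNgt hS // andbT.
  have neqo k : k \in S -> o != k.
    by move=> /(subsetP So); rewrite !inE eq_sym.
  by rewrite !mulf_neq0 ?M0 ?neqo.
Qed.
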